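(* Let $\mathcal{L}\subseteq\mathcal{L}'$ be first-order signatures, let $(\mathcal{K},\mu)$ be a measured $\mathcal{L}$-model class, and let $(\mathcal{K}',\mu')$ be the measured $\mathcal{L}'$-model class obtained from it by a conservative definitional expansion with expansion map $e:\mathcal{K}\to\mathcal{K}'$, $\mathcal{K}'=e(\mathcal{K})$, and $\mu'=e_\ast\mu$. Then for every $\mathcal{L}$-sentence $\varphi$, \[ \mu([\![\varphi]\!]_{\mathcal{K}})=\mu'([\![\varphi]\!]_{\mathcal{K}'}). \] Consequently, for $\mathcal{L}$-sentences the following are invariant under the expansion: almost-sure theories ($\mu([\![\varphi]\!]_{\mathcal{K}})=1$ iff $\mu'([\![\varphi]\!]_{\mathcal{K}'})=1$); threshold membership (for every $\tau\in(0,1)$, $\mu([\![\varphi]\!]_{\mathcal{K}})>\tau$ iff $\mu'([\![\varphi]\!]_{\mathcal{K}'})>\tau$); and prompt consequences expressed in $\mathcal{L}$ (for every $X\subseteq\mathcal{K}$ and prompt $p=(H_p,\rho_p)$ on $X$ with $H_p$ a finite set of $\mathcal{L}$-sentences and $\mathsf{Upd}_p(X)\ne\varnothing$, one has $p\Vdash_X\varphi$ iff $p'\Vdash_{e(X)}\varphi$, where $p'=(H_p,\rho_p\circ e^{-1})$ is the corresponding prompt on $e(X)$).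
   Context: For a class $\mathcal{K}$ of structures and a sentence $\varphi$, $[\![\varphi]\!]_{\mathcal{K}}:=\{\mathfrak{M}\in\mathcal{K}:\mathfrak{M}\models\varphi\}$. A measured model class is a pair $(\mathcal{K},\mu)$ with $\mu$ a probability measure on a $\sigma$-algebra containing all $[\![\varphi]\!]_{\mathcal{K}}$. Conservative definitional expansion: $T'$ is an $\mathcal{L}'$-theory such that every $\mathfrak{M}\in\mathcal{K}$ has a unique expansion $\mathfrak{M}'\models T'$ to $\mathcal{L}'$ and, for every $\mathcal{L}$-sentence $\varphi$, $\mathfrak{M}\models\varphi$ iff $\mathfrak{M}'\models\varphi$; $e(\mathfrak{M}):=\mathfrak{M}'$ (so $e$ is injective, $\mathfrak{M}$ being the $\mathcal{L}$-reduct of $\mathfrak{M}'$). Prompt: a pair $p=(H_p,\rho_p)$ on a set $X$ of structures, with $H_p$ a finite set of sentences and $\rho_p:X\to\Gamma_p$ a map into a well-ordered set; $\mathsf{Upd}_p(X)$ is the set of $\rho_p$-minimal elements of $\{\mathfrak{M}\in X:\mathfrak{M}\models H_p\}$; and $p\Vdash_X\varphi$ means that every $\mathfrak{M}\in\mathsf{Upd}_p(X)$ satisfies $\varphi$. *)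

(* Defs.v *)
From HB Require Import structures.
From mathcomp Require Import all_boot all_order all_algebra.
From mathcomp Require Import boolp classical_sets functions cardinality wochoice.
From mathcomp Require Import reals ereal measure.

Set Implicit Arguments.
Unset Strict Implicit.
Unset Printing Implicit Defensive.

Local Open Scope classical_set_scope.

(* First-order logic with equality.  Symbols are graded by their arity;        *)
(* constants are the function symbols of arity 0.                              *)
Record signature := Signature {
  fn_symb : nat -> Type;
  rel_symb : nat -> Type }.

Record structure (L : signature) := Structure {
  carrier :> Type;
  carrier_inhabited : inhabited carrier;
  fn_interp : forall k, fn_symb L k -> ('I_k -> carrier) -> carrier;
  rel_interp : forall k, rel_symb L k -> ('I_k -> carrier) -> Prop }.

(* [term L n] and [formula L n] have their free variables among 'I_n.  A       *)
(* quantifier binds variable 0 of its body; the others are shifted by one.     *)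
Inductive term (L : signature) (n : nat) : Type :=
| TVar of 'I_n
| TFn k of fn_symb L k & ('I_k -> term L n).

Inductive formula (L : signature) : nat -> Type :=
| FBot n : formula L n
| FEq n : term L n -> term L n -> formula L n
| FRel n k : rel_symb L k -> ('I_k -> term L n) -> formula L n
| FNot n : formula L n -> formula L n
| FAnd n : formula L n -> formula L n -> formula L n
| FOr n : formula L n -> formula L n -> formula L n
| FImp n : formula L n -> formula L n -> formula L n
| FAll n : formula L n.+1 -> formula L n
| FEx n : formula L n.+1 -> formula L n.

Arguments TFn {L n k}.
Arguments FBot {L n}.
Arguments FRel {L n k}.

Definition sentence (L : signature) := formula L 0.

Definition env_cons (T : Type) n (x : T) (v : 'I_n -> T) : 'I_n.+1 -> T :=
  fun j => oapp v x (unlift ord0 j).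

Fixpoint term_eval L (M : structure L) n (v : 'I_n -> M) (t : term L n) : M :=
  match t with
  | TVar j => v j
  | TFn k f args => fn_interp f (fun j => term_eval v (args j))
  end.

Fixpoint formula_sat L (M : structure L) n (phi : formula L n) :
    ('I_n -> M) -> Prop :=
  match phi in formula _ n return ('I_n -> M) -> Prop with
  | FBot _ => fun v => False
  | FEq _ t u => fun v => term_eval v t = term_eval v u
  | FRel _ k r args => fun v => rel_interp r (fun j => term_eval v (args j))
  | FNot _ phi => fun v => ~ formula_sat phi v
  | FAnd _ phi psi => fun v => formula_sat phi v /\ formula_sat psi v
  | FOr _ phi psi => fun v => formula_sat phi v \/ formula_sat psi v
  | FImp _ phi psi => fun v => formula_sat phi v -> formula_sat psi v
  | FAll _ phi => fun v => forall x : M, formula_sat phi (env_cons x v)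
  | FEx _ phi => fun v => exists x : M, formula_sat phi (env_cons x v)
  end.

Definition ord0_env (T : Type) : 'I_0 -> T :=
  fun j => False_rect T (notF (ltn_ord j)).

Definition satisfies L (M : structure L) (phi : sentence L) : Prop :=
  formula_sat phi (@ord0_env M).

Definition models L (M : structure L) (H : set (sentence L)) : Prop :=
  forall phi, H phi -> satisfies M phi.

(* The inclusion of signatures, as injective arity-preserving maps of symbols. *)
Record signature_incl (L L' : signature) := SignatureIncl {
  fn_incl : forall k, fn_symb L k -> fn_symb L' k;
  rel_incl : forall k, rel_symb L k -> rel_symb L' k;
  fn_incl_inj : forall k, injective (@fn_incl k);
  rel_incl_inj : forall k, injective (@rel_incl k) }.

Section SignatureInclusion.
Variables (L L' : signature) (i : signature_incl L L').

Fixpoint term_incl n (t : term L n) : term L' n :=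
  match t with
  | TVar j => TVar L' j
  | TFn k f args => TFn (fn_incl i f) (fun j => term_incl (args j))
  end.

Fixpoint formula_incl n (phi : formula L n) : formula L' n :=
  match phi with
  | FBot _ => FBot
  | FEq _ t u => FEq (term_incl t) (term_incl u)
  | FRel _ k r args => FRel (rel_incl i r) (fun j => term_incl (args j))
  | FNot _ phi => FNot (formula_incl phi)
  | FAnd _ phi psi => FAnd (formula_incl phi) (formula_incl psi)
  | FOr _ phi psi => FOr (formula_incl phi) (formula_incl psi)
  | FImp _ phi psi => FImp (formula_incl phi) (formula_incl psi)
  | FAll _ phi => FAll (formula_incl phi)
  | FEx _ phi => FEx (formula_incl phi)
  end.

Definition sentence_incl (phi : sentence L) : sentence L' := formula_incl phi.

Definition reduct (M' : structure L') : structure L :=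
  Structure (carrier_inhabited M')
    (fun k f => fn_interp (fn_incl i f)) (fun k r => rel_interp (rel_incl i r)).

Definition is_expansion (M : structure L) (M' : structure L') : Prop :=
  reduct M' = M.

Definition conservative_definitional_expansion
    (K : set (structure L)) (T' : set (sentence L')) : Prop :=
  (forall M, K M -> exists! M', is_expansion M M' /\ models M' T') /\
  (forall M M', K M -> is_expansion M M' -> models M' T' ->
    forall phi : sentence L, satisfies M phi <-> satisfies M' (sentence_incl phi)).

End SignatureInclusion.

HB.instance Definition _ L := gen_eqMixin (structure L).
HB.instance Definition _ L := gen_choiceMixin (structure L).
HB.instance Definition _ L := isPointed.Build (structure L)
  (@Structure L unit (inhabits tt) (fun _ _ _ => tt) (fun _ _ _ => False)).

(* Only meaningful at the structures that have exactly one expansion           *)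
(* satisfying [T'].                                                            *)
Definition expansion_map L L' (i : signature_incl L L')
    (T' : set (sentence L')) (M : structure L) : structure L' :=
  get [set M' | is_expansion i M M' /\ models M' T'].

Section RestrictToImage.
Variables (T U : Type) (f : T -> U) (A : set T).

Definition to_image (x : A) : f @` A :=
  exist _ (f (val x)) (mem_set (imageP f (set_valP x))).

(* The inverse of [to_image] when [f] is injective on [A].                     *)
Definition of_image (y : f @` A) : A :=
  let: exist2 x Ax _ := cid2 (set_valP y) in exist _ x (mem_set Ax).

End RestrictToImage.

Section MeasuredModelClasses.
Variable L : signature.

Definition truth_set (K : set (structure L)) (phi : sentence L) : set K :=
  [set M | satisfies (val M) phi].

(* The type of elements of [K], pointed through the proof of non-emptiness.    *)
Definition class_type (K : set (structure L)) (K0 : K !=set0) : Type :=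
  set_type K.

Section ClassType.
Variables (K : set (structure L)) (K0 : K !=set0).
HB.instance Definition _ := Choice.on (class_type K0).
HB.instance Definition _ := isPointed.Build (class_type K0)
  (exist _ (sval (cid K0)) (mem_set (svalP (cid K0)))).
End ClassType.

(* The data making a class [K] a measured model class.  A class carrying a     *)
(* probability measure is non-empty.  As [events] is a sigma-algebra, it is    *)
(* exactly the set of measurable sets of [g_sigma_algebraType events].         *)
Record measured_class (R : realType) (K : set (structure L)) := MeasuredClass {
  class_neq0 : K !=set0;
  events : set (set (class_type class_neq0));
  events_sigma_algebra : sigma_algebra setT events;
  events_truth_set : forall phi, events (@truth_set K phi);
  class_measure :> probability (g_sigma_algebraType events) R }.

End MeasuredModelClasses.

Arguments truth_set {L} K phi.
Arguments events {L R K}.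
Arguments class_neq0 {L R K}.
Arguments class_measure {L R K}.

(* [mu'] is the image measure of [mu] by [f : K -> f(K)].                      *)
Definition is_image_measure (R : realType) L L' (K : set (structure L))
    (f : structure L -> structure L')
    (mu : measured_class R K) (mu' : measured_class R (f @` K)) : Prop :=
  let fK : g_sigma_algebraType (events mu) -> g_sigma_algebraType (events mu') :=
    to_image f (A := K) in
  measurable_fun setT fK /\
  forall B, measurable B -> mu' B = pushforward mu fK B.

Section Prompts.
Variables (L : signature) (X : set (structure L)).

Record prompt := Prompt {
  prompt_hyps : set (sentence L);
  prompt_hyps_finite : finite_set prompt_hyps;
  prompt_disp : Order.disp_t;
  prompt_ranks : orderType prompt_disp;
  prompt_ranks_wo : well_order (<=%O : rel prompt_ranks);
  prompt_rank : X -> prompt_ranks }.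

Definition updates (p : prompt) : set X :=
  [set M | models (val M) (prompt_hyps p) /\
    ~ exists N : X, models (val N) (prompt_hyps p) /\
                    (prompt_rank p N < prompt_rank p M)%O].

Definition forces (p : prompt) (phi : sentence L) : Prop :=
  forall M : X, updates p M -> satisfies (val M) phi.

End Prompts.

Arguments prompt_ranks_wo {L X} p.

(* The prompt (H, rho o f^-1) on f(X), for [f] injective on [X]; its finite set *)
(* of sentences is H, read in the larger signature.                            *)
Definition image_prompt L L' (i : signature_incl L L') (X : set (structure L))
    (f : structure L -> structure L') (p : prompt X) : prompt (f @` X) :=
  Prompt (finite_image (sentence_incl i) (prompt_hyps_finite p))
    (prompt_ranks_wo p) (prompt_rank p \o of_image (f := f) (A := X)).

(* Main.v *)
(* The expansion map e preserves the truth of L-sentences, so the truth set of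
   phi in K is the preimage under e of its truth set in e(K); the equality of
   measures is then the definition of the image measure.  As M is the reduct of
   e(M), e is a bijection from X onto e(X), and it preserves both the hypotheses
   and the ranks of a prompt, hence also its updates. *)
Require Import Defs.
From mathcomp Require Import all_boot all_order all_algebra.
From mathcomp Require Import boolp classical_sets functions cardinality wochoice.
From mathcomp Require Import reals ereal measure.

Local Open Scope classical_set_scope.
Local Open Scope ring_scope.

Section ImageBijection.
Set Implicit Arguments.
Unset Strict Implicit.
Variables (T U : Type) (f : T -> U) (A : set T).

(** [of_image] chooses some preimage of [y], and [f] sends any choice back to [y]; injectivity
    matters only for the other composite, [to_imageK]. *)
Lemma val_of_image (y : f @` A) :
  f (val (of_image y)) = val y.
Proof. by rewrite /of_image; case: cid2. Qed.

Lemma to_imageK :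
  {in A &, injective f} -> cancel (to_image f (A := A)) (of_image (A := A)).
Proof.
by move=> f_inj x; apply/val_inj/f_inj; rewrite ?val_of_image //; exact: valP.
Qed.

End ImageBijection.

Section ExpansionMap.
Set Implicit Arguments.
Unset Strict Implicit.
Variables (L L' : signature) (i : signature_incl L L').
Variables (K : set (structure L)) (T' : set (sentence L')).
Hypothesis hT' : conservative_definitional_expansion i K T'.
Local Notation e := (expansion_map i T').

(** Existence of an expansion on [K] ensures that [get] returns an actual expansion and not its
    default point. *)
Lemma expansion_mapP M : K M -> is_expansion i M (e M) /\ models (e M) T'.
Proof.
move=> /(proj1 hT')[M' [M'P _]].
by apply: (getPex (P := [set N | is_expansion i M N /\ models N T'])); exists M'.
Qed.

(** Taking reducts is a left inverse of [e] on [K]. *)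
Lemma expansion_map_inj : {in K &, injective e}.
Proof.
move=> M N /set_mem/expansion_mapP[eM _] /set_mem/expansion_mapP[eN _] eMN.
by rewrite -eM -eN eMN.
Qed.

Lemma satisfies_expansion_map M phi : K M ->
  satisfies M phi <-> satisfies (e M) (sentence_incl i phi).
Proof.
by move=> KM; have [eM eT] := expansion_mapP KM; exact: (proj2 hT').
Qed.

Lemma models_expansion_map M H : K M ->
  models M H <-> models (e M) (sentence_incl i @` H).
Proof.
move=> KM; split=> [MH _ [phi Hphi <-]|eMH phi Hphi].
  by apply/satisfies_expansion_map => //; exact: MH.
by apply/satisfies_expansion_map => //; apply: eMH; exists phi.
Qed.

Lemma preimage_truth_set phi :
  to_image e (A := K) @^-1` truth_set (e @` K) (sentence_incl i phi) =
  truth_set K phi.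
Proof.
apply/seteqP; split=> M; rewrite /truth_set /=;
  by move/(satisfies_expansion_map phi (set_valP M)).
Qed.

Section ImagePrompt.
Variables (X : set (structure L)) (p : prompt X).
Hypothesis XK : X `<=` K.

(** An arbitrary point of the image is [e] of its chosen preimage, which lies in [K], so
    preservation of truth under [e] applies to it. *)
Lemma satisfies_of_image (M' : e @` X) phi :
  satisfies (val (of_image M')) phi <->
  satisfies (val M') (sentence_incl i phi).
Proof.
by rewrite -val_of_image; apply/satisfies_expansion_map/XK/set_valP.
Qed.

Lemma models_of_image (M' : e @` X) H :
  models (val (of_image M')) H <-> models (val M') (sentence_incl i @` H).
Proof.
by rewrite -val_of_image; apply/models_expansion_map/XK/set_valP.
Qed.

Lemma to_expansionK :
  cancel (to_image e (A := X)) (of_image (f := e) (A := X)).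
Proof.
by apply: to_imageK => M N /set_mem/XK/mem_set KM /set_mem/XK/mem_set;
  exact: expansion_map_inj.
Qed.

Lemma updates_image_prompt (M' : e @` X) :
  updates (image_prompt i e p) M' <-> updates p (of_image M').
Proof.
split=> -[MH minM]; split.
- exact/models_of_image.
(* A better-ranked [N] in [X] is pushed into the image. Its rank there is that of
   [of_image (to_image e N)], which is [N] by injectivity. *)
- move=> [N [NH ltNM]]; apply: minM; exists (to_image e N).
  rewrite /= to_expansionK; split=> //.
  exact/models_expansion_map/NH/XK/set_valP.
- exact/models_of_image.
(* Pulling a competitor back keeps its rank by definition of [image_prompt]. *)
- move=> [N [NH ltNM]]; apply: minM; exists (of_image N); split=> //.
  exact/models_of_image.
Qed.

Lemma forces_image_prompt phi :
  forces p phi <-> forces (image_prompt i e p) (sentence_incl i phi).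
Proof.
split=> [pphi M' /updates_image_prompt/pphi/satisfies_of_image //|pphi M updM].
(* Every [M] in [X] is the pullback of its own image, so the hypothesis on the image prompt reaches
   it. *)
rewrite -(to_expansionK M); apply/satisfies_of_image/pphi.
by apply/updates_image_prompt; rewrite to_expansionK.
Qed.

End ImagePrompt.

Lemma image_measure_truth_set (R : realType) (mu : measured_class R K)
    (mu' : measured_class R (e @` K)) phi : is_image_measure mu mu' ->
  mu (truth_set K phi) = mu' (truth_set (e @` K) (sentence_incl i phi)).
Proof.
move=> [_ ->]; first by rewrite /pushforward preimage_truth_set.
(* The image-measure identity concerns measurable sets only; the truth set is one, being among the
   generating events. *)
by apply: sub_sigma_algebra; exact: events_truth_set.
Qed.

End ExpansionMap.

Theorem theorem2p30 (R : realType) (L L' : signature) (i : signature_incl L L')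
    (K : set (structure L)) (mu : measured_class R K)
    (T' : set (sentence L')) (hT' : conservative_definitional_expansion i K T')
    (mu' : measured_class R (expansion_map i T' @` K))
    (hmu' : is_image_measure mu mu') :
  (forall phi : sentence L,
    mu (truth_set K phi)
      = mu' (truth_set (expansion_map i T' @` K) (sentence_incl i phi))) /\
  (forall phi : sentence L,
    mu (truth_set K phi) = 1%E <->
    mu' (truth_set (expansion_map i T' @` K) (sentence_incl i phi)) = 1%E) /\
  (forall (phi : sentence L) (tau : R), 0 < tau < 1 ->
    ((tau%:E < mu (truth_set K phi))%E <->
     (tau%:E < mu' (truth_set (expansion_map i T' @` K) (sentence_incl i phi)))%E)) /\
  (forall (phi : sentence L) (X : set (structure L)) (p : prompt X),
    X `<=` K -> updates p !=set0 ->
    (forces p phi <->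
     forces (image_prompt i (expansion_map i T') p) (sentence_incl i phi))).
Proof.
have mu_eq phi := image_measure_truth_set hT' phi hmu'.
split=> //; split; first by move=> phi; rewrite mu_eq.
split=> [phi tau _|phi X p XK _]; first by rewrite mu_eq.
exact (forces_image_prompt hT' p XK phi).
Qed.
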